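(* For every integer $n\ge 6$, the inclusion $\bigcup_{r\in\mathbb N}\mathcal K_n^{(r)}\subset \mathrm{COP}_n$ is strict, and consequently the cone $\bigcup_{r\in\mathbb N}\mathcal K_n^{(r)}$ is not a closed set.
   Context: Let $\mathcal S^n$ be the space of real symmetric $n\times n$ matrices and $\mathbb N=\{0,1,2,\dots\}$. For $x\in\mathbb R^n$ put $x^{\circ 2}=(x_1^2,\dots,x_n^2)$. The copositive cone is $\mathrm{COP}_n=\{M\in\mathcal S^n: (x^{\circ 2})^TMx^{\circ 2}\ge 0 \text{ for all } x\in\mathbb R^n\}$. Let $\Sigma$ denote the set of finite sums of squares of real polynomials in $x_1,\dots,x_n$. For $r\in\mathbb N$, $\mathcal K_n^{(r)}=\{M\in\mathcal S^n: (\sum_{i=1}^n x_i^2)^r\,(x^{\circ 2})^TMx^{\circ 2}\in\Sigma\}$. It is known that $\mathrm{int}(\mathrm{COP}_n)\subseteq\bigcup_{r}\mathcal K_n^{(r)}\subseteq \mathrm{COP}_n$. *)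

(* Defs.v *)
From HB Require Import structures.
From mathcomp Require Import all_boot all_order all_algebra.
From mathcomp Require Import boolp classical_sets reals topology normedtype.
(* The notations of mpoly clash with those of the analysis library. *)
From mathcomp Require Import -(notations) mpoly.

Set Implicit Arguments.
Unset Strict Implicit.
Unset Printing Implicit Defensive.

Import Order.TTheory GRing.Theory Num.Theory.
Import numFieldNormedType.Exports.

Local Open Scope classical_set_scope.
Local Open Scope ring_scope.

Definition hadamard_sq (A : comNzRingType) (n : nat) (x : 'cV[A]_n) :
  'cV[A]_n := map_mx (fun t => t ^+ 2) x.

(* Used below both with A = R (values at points) and with A = R[x_1,..,x_n]
   (as a formal polynomial). *)
Definition sq_form (A : comNzRingType) (n : nat) (M : 'M[A]_n) (x : 'cV[A]_n) :
  A := ((hadamard_sq x)^T *m M *m hadamard_sq x) 0 0.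

Definition sym_mx (R : realType) (n : nat) : set 'M[R]_n :=
  [set M | M^T = M].
Arguments sym_mx : clear implicits.

Definition copositive_cone (R : realType) (n : nat) : set 'M[R]_n :=
  [set M | sym_mx R n M /\ forall x : 'cV[R]_n, 0 <= sq_form M x].
Arguments copositive_cone : clear implicits.

Definition is_sos (R : realType) (n : nat) (p : mpoly n R) : Prop :=
  exists s : seq (mpoly n R), p = \sum_(q <- s) q ^+ 2.

Definition mvar (R : realType) (n : nat) (i : 'I_n) : mpoly n R :=
  mpolyX R (mnm1 i).

Definition sq_form_poly (R : realType) (n : nat) (M : 'M[R]_n) :
  mpoly n R :=
  sq_form (map_mx (@mpolyC n R) M) (\col_i mvar R i).

Definition parrilo_cone (R : realType) (n r : nat) : set 'M[R]_n :=
  [set M | sym_mx R n M /\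
           is_sos ((\sum_(i < n) mvar R i ^+ 2) ^+ r * sq_form_poly M)].
Arguments parrilo_cone : clear implicits.

(* Main.v *)
Require Import Defs.
From mathcomp Require Import all_boot all_order all_algebra.
From mathcomp Require Import boolp classical_sets reals topology normedtype.
From mathcomp Require Import -(notations) mpoly.
From mathcomp Require Import ring lra.
Import Order.TTheory GRing.Theory Num.Theory.
Import numFieldNormedType.Exports.
Local Open Scope classical_set_scope.
Local Open Scope ring_scope.

Set Implicit Arguments.
Unset Strict Implicit.
Unset Printing Implicit Defensive.

(** The Horn matrix [H] is copositive, but its form is not a sum of squares:
    a square [q ^+ 2] in a decomposition vanishes where the form does, in
    particular at [e_i + e_(i+1)] and [e_i - e_(i+1)] (indices mod 5), so by
    the parallelogram law [q(e_i) = - q(e_(i+1))]; as 5 is odd, [q(e_0) = 0],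
    whereas the form is 1 at [e_0].  Padding [H] with a zero row [z] defeats the
    multiplier [(sum x_i^2)^r]: around the point [e_z] the multiplier equals 1
    to lowest order, so a decomposition of the product yields one of the form
    of [H] itself.  For non-closedness, [M + e J] lies in some [K^(r)] for
    every copositive [M] and [e > 0] (Polya's theorem for quadratic forms). *)

(** * Values of the form at unit vectors and their combinations *)

Section SqForm.
Variables (A : comNzRingType) (n : nat).
Implicit Types (M : 'M[A]_n) (x : 'cV[A]_n).

Lemma sq_formE M x :
  sq_form M x = \sum_i \sum_j M i j * (x i 0 ^+ 2 * x j 0 ^+ 2).
Proof.
rewrite /sq_form mxE exchange_big /=; apply: eq_bigr => j _.
rewrite mxE mulr_suml; apply: eq_bigr => i _.
by rewrite !mxE; ring.
Qed.

Lemma sq_form0 M : sq_form M 0 = 0.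
Proof.
by rewrite sq_formE big1 // => i _; rewrite big1 // => j _; rewrite !mxE; ring.
Qed.

Lemma sq_form_delta M i : sq_form M (delta_mx i 0) = M i i.
Proof.
rewrite /sq_form.
have -> : hadamard_sq (delta_mx i 0) = delta_mx i 0 :> 'cV[A]_n.
  by apply/matrixP=> k l; rewrite !mxE; case: (_ && _); rewrite /=; ring.
by rewrite trmx_delta -rowE -colE !mxE.
Qed.

(** Squaring the entries forgets the sign of [c], so one statement serves for both [e_i + e_j] and
    [e_i - e_j]. *)
Lemma sq_form_delta2 M i j (c : A) : i != j -> c ^+ 2 = 1 ->
  sq_form M (delta_mx i 0 + c *: delta_mx j 0) =
  M i i + M i j + (M j i + M j j).
Proof.
move=> nij c1; rewrite /sq_form.
have -> : hadamard_sq (delta_mx i 0 + c *: delta_mx j 0) =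
    delta_mx i 0 + delta_mx j 0 :> 'cV[A]_n.
  apply/matrixP=> k l; rewrite !mxE ord1 eqxx !andbT.
  have [->|] := eqVneq k i; first by rewrite (negbTE nij) /=; ring.
  by case: (k == j) => _ /=; rewrite ?mulr1 ?mulr0 ?add0r ?c1 //; ring.
rewrite [(_ + _)^T]linearD /= !trmx_delta !mulmxDl !mulmxDr -!rowE -!colE.
by rewrite !mxE.
Qed.

End SqForm.

(** * Evaluation at points and expansion along lines through [e_z] *)

Section Substitution.
Variables (R : realType) (n : nat).
Implicit Types (M : 'M[R]_n) (p q : mpoly n R).

Lemma mpoly_ring_ind (P : mpoly n R -> Prop) :
  (forall c, P (mpolyC n c)) -> (forall i, P (mvar R i)) ->
  (forall p q, P p -> P q -> P (p + q)) ->
  (forall p q, P p -> P q -> P (p * q)) -> forall p, P p.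
Proof.
move=> PC PX PD PM p.
have P0 : P 0 by rewrite -(mpolyC0 n R); exact: PC.
have P1 : P 1 by exact: (PC 1).
rewrite (mpolyE p); apply: (big_ind P) => // m _.
rewrite -mul_mpolyC; apply: (PM) => //; rewrite mpolyXE_id.
apply: (big_ind P P1 PM) => i _.
by elim: (m i) => [|k IH]; rewrite ?expr0 // exprS; exact: PM (PX i) IH.
Qed.

(** Serves twice: with [idfun] to evaluate at real points, and with [polyC] to restrict to a
    line. *)
Lemma mmap_parrilo (B : comNzRingType) (f : {rmorphism R -> B}) (h : 'cV[B]_n)
    r M :
  mmap f (h^~ 0) ((\sum_(i < n) mvar R i ^+ 2) ^+ r * sq_form_poly M) =
  (\sum_i h i 0 ^+ 2) ^+ r * sq_form (map_mx f M) h.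
Proof.
have mmapXU i : mmap f (h^~ 0) (mvar R i) = h i 0 by rewrite mmapX mmap1U.
rewrite rmorphM rmorphXn rmorph_sum /=; congr (_ ^+ r * _).
  by apply: eq_bigr => i _; rewrite rmorphXn /= mmapXU.
rewrite /sq_form_poly !sq_formE rmorph_sum; apply: eq_bigr => i _ /=.
rewrite rmorph_sum; apply: eq_bigr => j _ /=.
by rewrite !mxE 2!rmorphM !rmorphXn /= !mmapXU mmapC.
Qed.

Lemma parrilo_sub_copositive r : parrilo_cone R n r `<=` copositive_cone R n.
Proof.
move=> M [symM [s sE]]; split=> // x.
have [->|x0] := eqVneq x 0; first by rewrite sq_form0.
have S0 : 0 < \sum_i x i 0 ^+ 2.
  rewrite lt_def sumr_ge0 ?andbT => [|i _]; last exact: sqr_ge0.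
  apply: contraNneq x0 => /eqP.
  rewrite psumr_eq0 => [/allP x0|i _]; last exact: sqr_ge0.
  apply/eqP/matrixP=> i j; rewrite ord1 !mxE; apply/eqP.
  by rewrite -sqrf_eq0; exact: x0 (mem_index_enum i).
have := mmap_parrilo idfun x r M; rewrite sE rmorph_sum /= => E.
rewrite -(pmulr_rge0 _ (exprn_gt0 r S0)).
rewrite (_ : M = map_mx idfun M) -?E; last by apply/matrixP=> i j; rewrite mxE.
by apply: sumr_ge0 => q _; rewrite rmorphXn /= sqr_ge0.
Qed.

(* Substitutes for the variables the point [e_z + X a] of the line through
   [e_z] with direction [a]. *)
Definition line_subst (z : 'I_n) (a : 'cV[R]_n) : 'cV[{poly R}]_n :=
  \col_j ((j == z)%:R%:P + (a j 0)%:P * 'X).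

Definition line_coef (z : 'I_n) (k : nat) (q : mpoly n R) (a : 'cV[R]_n) : R :=
  (mmap polyC ((line_subst z a)^~ 0) q)`_k.

(* The coefficient of ['X ^+ 2] is a quadratic form in the direction; the
   parallelogram law is all that is needed of this. *)
Lemma line_coef_jet z q :
  [/\ forall a b, line_coef z 0 q a = line_coef z 0 q b,
      forall a b,
        line_coef z 1 q (a + b) = line_coef z 1 q a + line_coef z 1 q b,
      forall a, line_coef z 1 q (- a) = - line_coef z 1 q a &
      forall a b, line_coef z 2 q (a + b) + line_coef z 2 q (a - b) =
                  (line_coef z 2 q a + line_coef z 2 q b) *+ 2].
Proof.
elim/mpoly_ring_ind: q => [c|i|p q|p q].
- by rewrite /line_coef; split=> *;
    rewrite ?mmapC !coefC /= ?addr0 ?oppr0 ?mul0rn.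
- rewrite /line_coef; split=> *;
    rewrite !mmapX !mmap1U !mxE !coefD !coefC !coefCM !coefX /=; ring.
- case=> p0 p1 p1' p2 [q0 q1 q1' q2].
  have E k a : line_coef z k (p + q) a = line_coef z k p a + line_coef z k q a.
    by rewrite /line_coef rmorphD coefD.
  split=> a => [b|b||b]; rewrite !E ?p1 ?q1 ?p1' ?q1'; first by rewrite (p0 a b) (q0 a b).
  - by ring.
  - by ring.
  by rewrite addrACA p2 q2; ring.
- case=> p0 p1 p1' p2 [q0 q1 q1' q2].
  have E k a : line_coef z k (p * q) a =
      \sum_(j < k.+1) line_coef z j p a * line_coef z (k - j) q a.
    by rewrite /line_coef rmorphM coefM.
  split=> a => [b|b||b]; rewrite !E !big_ord_recr !big_ord0 /= ?subn0 ?subnn ?subn1 /=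
    ?p1 ?q1 ?p1' ?q1' ?(p0 (a + b) a) ?(q0 (a + b) a)
    ?(p0 (a - b) a) ?(q0 (a - b) a) ?(p0 (- a) a) ?(q0 (- a) a)
    ?(p0 b a) ?(q0 b a).
  - by ring.
  - by ring.
  - by ring.
  (* Once the parallelogram law has eliminated the values at [a + b], the expansion of the product
     rule is a ring identity. *)
  have -> : line_coef z 2 p (a + b) =
      (line_coef z 2 p a + line_coef z 2 p b) *+ 2 - line_coef z 2 p (a - b).
    by rewrite -p2 addrK.
  have -> : line_coef z 2 q (a + b) =
      (line_coef z 2 q a + line_coef z 2 q b) *+ 2 - line_coef z 2 q (a - b).
    by rewrite -q2 addrK.
  by ring.
Qed.

(** The coefficients of degree 0 and then 2 on the left are sums of real squares equal to 0. Hence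
    every [F t] is divisible by ['X^2], and only its coefficient of degree 2 contributes in degree
    4. *)
Lemma sum_sqr_poly_low_coef (T : eqType) (s : seq T) (F : T -> {poly R})
    (u : {poly R}) :
  \sum_(t <- s) F t ^+ 2 = 'X^4 * u -> \sum_(t <- s) (F t)`_2 ^+ 2 = u`_0.
Proof.
move=> E.
have C k : \sum_(t <- s) (F t ^+ 2)`_k = ('X^4 * u)`_k by rewrite -coef_sum E.
have z0 t : t \in s -> (F t)`_0 = 0.
  have := C 0; rewrite coefXnM /= => /eqP; rewrite psumr_eq0 => [/allP H ts|i _].
    by have := H t ts; rewrite expr2 coefM big_ord1 mulf_eq0 orbb => /eqP.
  by rewrite expr2 coefM big_ord1 -expr2 sqr_ge0.
have c2 t : t \in s -> (F t ^+ 2)`_2 = (F t)`_1 ^+ 2.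
  by move=> ts; rewrite expr2 coefM !big_ord_recr big_ord0 /= z0 // subn1 /=; ring.
have z1 t : t \in s -> (F t)`_1 = 0.
  have := C 2; rewrite coefXnM /= (eq_big_seq _ c2) => /eqP.
  rewrite psumr_eq0 => [/allP H ts|i _]; last exact: sqr_ge0.
  by apply/eqP; rewrite -sqrf_eq0; exact: H.
have := C 4; rewrite coefXnM /= subnn => <-; apply: eq_big_seq => t ts.
rewrite expr2 coefM !big_ord_recr big_ord0 /= z0 // z1 //.
by rewrite !mul0r !mulr0 !add0r !addr0.
Qed.

(** As row and column [z] of [M] vanish, the form at [e_z + X a] is ['X^4] times its value at [a],
    while the multiplier has constant term 1; the degree 4 coefficients are then compared. *)
Lemma parrilo_zero_row_sos r M (z : 'I_n) : parrilo_cone R n r M ->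
  (forall j, M z j = 0) ->
  exists s : seq (mpoly n R), forall a,
    \sum_(q <- s) line_coef z 2 q a ^+ 2 = sq_form M a.
Proof.
move=> [symM [s sE]] Mz; exists s => a.
have Mz' j : M j z = 0 by rewrite -symM mxE.
have := mmap_parrilo polyC (line_subst z a) r M.
rewrite sE rmorph_sum /= (_ : sq_form _ _ = 'X^4 * (sq_form M a)%:P); last first.
  rewrite !sq_formE rmorph_sum mulr_sumr; apply: eq_bigr => i _ /=.
  rewrite rmorph_sum mulr_sumr; apply: eq_bigr => j _ /=; rewrite !mxE.
  have [->|ni] := eqVneq i z; first by rewrite Mz polyC0 !mul0r mulr0.
  have [->|nj] := eqVneq j z; first by rewrite Mz' polyC0 !mul0r mulr0.
  by rewrite !mulr0n !polyC0 !add0r 2!polyCM !polyC_exp; ring.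
rewrite mulrCA; under eq_bigr do rewrite rmorphXn /=.
move/sum_sqr_poly_low_coef; rewrite /line_coef => ->.
rewrite mulrC coefCM -horner_coef0 horner_exp horner_sum.
rewrite (bigD1 z) //= big1 => [|i nz].
  by rewrite !mxE eqxx !hornerE /= ?mulr0 ?addr0 !expr1n ?addr0 ?expr1n ?mulr1.
by rewrite !mxE (negbTE nz) !hornerE /=; ring.
Qed.

End Substitution.

(** * Polya's theorem for quadratic forms, and its consequence for closedness *)

Lemma copositive_bilinear_ge0 (R : realType) n (M : 'M[R]_n) (y : 'I_n -> R) :
  copositive_cone R n M -> (forall i, 0 <= y i) ->
  0 <= \sum_i \sum_j M i j * (y i * y j).
Proof.
move=> [_ cop] y0; have := cop (\col_i Num.sqrt (y i)); rewrite sq_formE.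
congr (_ <= _); apply: eq_bigr => i _; apply: eq_bigr => j _.
by rewrite !mxE !sqr_sqrtr.
Qed.

(* Expanding [(\sum_i y i) ^+ r * \sum_i \sum_j M i j * (y i * y j)] into words
   of length [r.+2], the two letters carrying [M] may sit at any two distinct
   positions [a], [b]; averaging over these positions gives every word a
   nonnegative coefficient once [r] is large. *)
Lemma sum_words_mulE (B : comNzRingType) n r (y : 'I_n -> B)
    (M : 'I_n -> 'I_n -> B) (a b : 'I_r.+2) : a != b ->
  \sum_(w : {ffun 'I_r.+2 -> 'I_n}) M (w a) (w b) * \prod_k y (w k) =
  (\sum_i y i) ^+ r * \sum_i \sum_j M i j * (y i * y j).
Proof.
move=> nab.
transitivity (\sum_i \sum_j M i j * \sum_(w : {ffun 'I_r.+2 -> 'I_n})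
    (w a == i)%:R * (w b == j)%:R * \prod_k y (w k)).
  under [RHS]eq_bigr => i _ do (under eq_bigr do rewrite mulr_sumr;
    rewrite exchange_big /=).
  rewrite exchange_big /=; apply: eq_bigr => w _.
  rewrite (bigD1 (w a)) //= [X in _ = _ + X]big1 => [|i]; last first.
    rewrite eq_sym => /negbTE ni; rewrite big1 // => j _.
    by rewrite ni !mul0r mulr0.
  rewrite (bigD1 (w b)) //= [X in _ = _ + X + _]big1 => [|j]; last first.
    by rewrite eq_sym => /negbTE nj; rewrite nj mulr0 mul0r mulr0.
  by rewrite !eqxx !mul1r !addr0.
rewrite mulr_sumr; apply: eq_bigr => i _; rewrite mulr_sumr.
apply: eq_bigr => j _; rewrite mulrCA; congr (_ * _).
(* The constraints on the letters at [a] and [b] factor over the positions, so distributivity turns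
   the sum over words into a product of sums over letters. *)
pose g k x : B := ((k == a) ==> (x == i))%:R * ((k == b) ==> (x == j))%:R * y x.
transitivity (\sum_(w : {ffun 'I_r.+2 -> 'I_n}) \prod_k g k (w k)).
  apply: eq_bigr => w _; rewrite /g !big_split /=; congr (_ * _ * _).
    rewrite (bigD1 a) //= eqxx big1 ?mulr1 // => k /negbTE ->; exact: erefl.
  rewrite (bigD1 b) //= eqxx big1 ?mulr1 // => k /negbTE ->; exact: erefl.
rewrite -bigA_distr_bigA (bigD1 a) //= (bigD1 b) 1?eq_sym //= mulrA mulrC.
have nba : (b == a) = false by rewrite eq_sym; exact: negbTE.
congr (_ * (_ * _)).
- rewrite (eq_bigr (fun=> \sum_x y x)) => [|k /andP[/negbTE ka /negbTE kb]].
    rewrite prodr_const; congr (_ ^+ _).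
    have := cardC (pred2 a b); rewrite card2 nab card_ord => -[Er]; rewrite -[RHS]Er.
    by apply: eq_card => k; rewrite !inE negb_or.
  by apply: eq_bigr => x _; rewrite /g ka kb !mul1r.
- rewrite (bigD1 i) //= big1 => [|x /negbTE xi]; rewrite /g eqxx (negbTE nab) /=.
    by rewrite eqxx !mul1r addr0.
  by rewrite xi !mul0r.
- rewrite (bigD1 j) //= big1 => [|x /negbTE xj]; rewrite /g eqxx nba /=.
    by rewrite eqxx !mul1r addr0.
  by rewrite xj mulr0 !mul0r.
Qed.

(** Here [c i] counts the occurrences of the letter [i]; copositivity of [M] applies to this
    nonnegative vector. *)
Lemma sum_word_pairsE (R : comNzRingType) n N (M : 'I_n -> 'I_n -> R)
    (w : 'I_N -> 'I_n) (c := fun i => \sum_a (w a == i)%:R) :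
  \sum_a \sum_b M (w a) (w b) = \sum_i \sum_j M i j * (c i * c j).
Proof.
have part (F : 'I_n -> R) : \sum_a F (w a) = \sum_i F i * c i.
  under [RHS]eq_bigr do rewrite mulr_sumr.
  rewrite exchange_big; apply: eq_bigr => a _ /=.
  rewrite (bigD1 (w a)) //= eqxx mulr1 big1 ?addr0 // => i.
  by rewrite eq_sym => /negbTE ->; rewrite mulr0.
rewrite (part (fun i => \sum_b M i (w b))); apply: eq_bigr => i _.
rewrite part mulr_suml; apply: eq_bigr => j _; ring.
Qed.

Lemma copositive_add_const_parrilo (R : realType) n (M : 'M[R]_n) (e : R) :
  copositive_cone R n M -> 0 < e ->
  exists r, parrilo_cone R n r (M + const_mx e).
Proof.
move=> copM e0.
(* [D] bounds every diagonal entry of [M + const_mx e]. *)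
pose D := \sum_i `|M i i| + e.
have [r Dr] : exists r, D <= e * r.+2%:R.
  exists (Num.bound (D / e)); rewrite mulrC -ler_pdivrMr //.
  apply: le_trans (ltW (archi_boundP _)) _; last by rewrite ler_nat -addn2 leq_addr.
  by rewrite divr_ge0 ?(ltW e0) // addr_ge0 ?(ltW e0) // sumr_ge0.
exists r; split.
  by case: copM => symM _; rewrite /sym_mx /= linearD /= symM; congr (_ + _);
    apply/matrixP=> i j; rewrite !mxE.
pose W := {ffun 'I_r.+2 -> 'I_n}.
pose P := [pred p : 'I_r.+2 * 'I_r.+2 | p.2 != p.1].
pose C (w : W) := \sum_(p | P p) (M + const_mx e) (w p.1) (w p.2).
have K0 : (0 : R) < #|P|%:R.
  by rewrite ltr0n; apply/card_gt0P; exists (ord0, ord_max).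
have C0 w : 0 <= C w.
  (* Restoring the pairs of equal positions completes the form of [M] at the letter counts. The
     contribution of [e] grows quadratically in the word length, and the diagonal correction only
     linearly. *)
  have -> : C w = \sum_a \sum_b M (w a) (w b) +
      \sum_a (e * r.+2%:R - (M (w a) (w a) + e)).
    rewrite /C -big_split /= -(pair_big_dep xpredT (fun a b => b != a)
      (fun a b => (M + const_mx e) (w a) (w b))) /=.
    apply: eq_bigr => a _.
    rewrite [in RHS](eq_bigr (fun b => (M + const_mx e) (w a) (w b) - e)); last first.
      by move=> b _; rewrite !mxE addrK.
    rewrite sumrB sumr_const card_ord [in RHS](bigD1 a) //=.
    rewrite -[e *+ _]mulr_natr !mxE; ring.
  apply: addr_ge0.
    rewrite (sum_word_pairsE (fun i j => M i j)).
    by apply: (copositive_bilinear_ge0 copM) => i; apply: sumr_ge0.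
  apply: sumr_ge0 => a _; rewrite subr_ge0; apply: le_trans Dr.
  rewrite /D lerD2r (bigD1 (w a)) //=.
  by apply: le_trans (ler_norm _) _; rewrite lerDl sumr_ge0.
have E : ((\sum_(i < n) mvar R i ^+ 2) ^+ r *
    sq_form_poly (M + const_mx e)) *+ #|P| =
    \sum_(w : W) C w *: (\prod_k mvar R (w k)) ^+ 2.
  rewrite -sumr_const.
  under [RHS]eq_bigr do rewrite /C scaler_suml.
  rewrite [RHS]exchange_big /=; apply: eq_bigr => -[a b] /= nab.
  rewrite /sq_form_poly sq_formE.
  under [RHS]eq_bigr do rewrite -mul_mpolyC -prodrXl.
  rewrite (sum_words_mulE (fun i => mvar R i ^+ 2)
    (fun i j => mpolyC n ((M + const_mx e) i j))) 1?eq_sym //.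
  congr (_ * _); apply: eq_bigr => i _; apply: eq_bigr => j _.
  by rewrite !mxE.
exists [seq Num.sqrt (C w / #|P|%:R) *: \prod_k mvar R (w k) | w : W].
rewrite big_image /=.
transitivity (#|P|%:R^-1 *: \sum_(w : W) C w *: (\prod_k mvar R (w k)) ^+ 2).
  by rewrite -E -[X in _ = _ *: X]scaler_nat scalerA mulVf ?gt_eqF // scale1r.
rewrite scaler_sumr; apply: eq_bigr => w _.
by rewrite exprZn sqr_sqrtr ?divr_ge0 ?(ltW K0) // scalerA mulrC.
Qed.

Lemma copositive_sub_closed_bigcup_parrilo (R : realType) n :
  closed (\bigcup_r parrilo_cone R n r : set (subspace (sym_mx R n))) ->
  copositive_cone R n `<=` \bigcup_r parrilo_cone R n r.
Proof.
move=> clK M copM; apply: (clK M) => U.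
have symM : sym_mx R n M by case: copM.
(* At a symmetric matrix the neighbourhoods are traces of ambient ones, so the perturbed matrix must
   be both close to [M] and symmetric. *)
rewrite [nbhs _](esym (nbhs_subspace_in symM)).
move=> /nbhs_ballP[e /= e0 sub].
have e20 : 0 < e / 2 by rewrite divr_gt0.
have [r Kr] := copositive_add_const_parrilo copM e20.
exists (M + const_mx (e / 2)); split; first by exists r.
apply: sub; last by case: Kr.
split=> // i j; rewrite !mxE /ball /= opprD addNKr normrN gtr0_norm //.
by rewrite ltr_pdivrMr // ltr_pMr // ltr1n.
Qed.

(** * The padded Horn matrix: copositive, but in none of the cones *)

Section Horn.
Variables (R : realType) (m : nat).

Definition horn_entry (i j : nat) : R :=
  if (4 < i)%N || (4 < j)%N then 0 else
  if i == j then 1 else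
  if (j == i.+1 %% 5)%N || (i == j.+1 %% 5)%N then -1 else 1.

Definition horn_mx : 'M[R]_m.+4.+2 := \matrix_(i, j) horn_entry i j.

Lemma horn_mx_sym : horn_mx^T = horn_mx.
Proof.
by apply/matrixP=> i j; rewrite !mxE /horn_entry orbC
  [(_ == _ :> nat)]eq_sym [in if (_ == _ %% 5)%N || _ then _ else _]orbC.
Qed.

Lemma horn_mx_copositive : copositive_cone R m.+4.+2 horn_mx.
Proof.
split=> [|x]; first exact: horn_mx_sym.
pose y k : R := x (inord k) 0 ^+ 2.
have y0 k : 0 <= y k by exact: sqr_ge0.
have sum5 (F : nat -> R) : (forall i, F (5 + i)%N = 0) ->
    \sum_(i < m.+4.+2) F i = \sum_(i < 5) F i.
  move=> F0; rewrite -[m.+4.+2]/(5 + m.+1)%N big_split_ord /=.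
  by rewrite [X in _ + X]big1 ?addr0.
have -> : sq_form horn_mx x =
    \sum_(i < 5) \sum_(j < 5) horn_entry i j * (y i * y j).
  rewrite sq_formE -(sum5 (fun i => \sum_(j < 5) horn_entry i j * (y i * y j))).
    apply: eq_bigr => i _.
    rewrite -(sum5 (fun j => horn_entry i j * (y i * y j))) => [|j].
      by apply: eq_bigr => j _; rewrite mxE /y !inord_val.
    by rewrite /horn_entry orbT mul0r.
  by move=> i; rewrite big1 // => j _; rewrite mul0r.
rewrite !big_ord_recr !big_ord0 /= /horn_entry /=.
have := (y0 0, y0 1, y0 2, y0 3, y0 4)%N.
move: (y 0%N) (y 1%N) (y 2%N) (y 3%N) (y 4%N) => {x y y0 sum5} a b c d e.
move=> [[[[a0 b0] c0] d0] e0].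
(* The signs of [d] and [e] inside the square are chosen by their order, so that the remainder is a
   sum of products of nonnegative numbers. *)
have [de|/ltW ed] := leP d e.
  rewrite (_ : _ + _ = (a - b + c + d - e) ^+ 2 + 4 * (b * d) +
    4 * (c * (e - d))); last by ring.
  by rewrite !addr_ge0 ?sqr_ge0 ?mulr_ge0 ?subr_ge0.
rewrite (_ : _ + _ = (a - b + c - d + e) ^+ 2 + 4 * (b * e) +
  4 * (a * (d - e))); last by ring.
by rewrite !addr_ge0 ?sqr_ge0 ?mulr_ge0 ?subr_ge0.
Qed.

Lemma horn_mx_notin_parrilo r : ~ parrilo_cone R m.+4.+2 r horn_mx.
Proof.
move=> Kr; pose v k : 'cV[R]_m.+4.+2 := delta_mx (inord k) 0.
have lt6 k : (k < 5)%N -> (k < m.+4.+2)%N by move=> k5; apply: leq_trans k5 _.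
have hE i j : (i < 5)%N -> (j < 5)%N ->
    horn_mx (inord i) (inord j) = horn_entry i j.
  by move=> i5 j5; rewrite mxE !inordK // lt6.
have z0 j : horn_mx (inord 5) j = 0 by rewrite mxE inordK.
have [s sE] := parrilo_zero_row_sos Kr z0.
(* With the multiplier removed, the quadratic part of [q] at the padding index 5 takes the place of
   [q] in the parity argument around the 5-cycle. *)
pose G q k := line_coef (inord 5) 2 q (v k).
have next q i (j := (i.+1 %% 5)%N) : q \in s -> (i < 5)%N -> G q i = - G q j.
  move=> qs i5.
  have j5 : (j < 5)%N by rewrite ltn_mod.
  have nij : (inord i : 'I_m.+4.+2) != inord j.
    rewrite -val_eqE /= !inordK ?lt6 //.
    by rewrite /j; move: i i5 {j j5} => [|[|[|[|[|]]]]].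
  have sum0 : horn_entry i i + horn_entry i j +
      (horn_entry j i + horn_entry j j) = 0.
    rewrite /j /horn_entry; move: i i5 {j j5 nij} => [|[|[|[|[|]]]]] //= _; ring.
  have zero c : c ^+ 2 = 1 -> line_coef (inord 5) 2 q (v i + c *: v j) = 0.
    move=> c1; have := sE (v i + c *: v j).
    rewrite sq_form_delta2 // !hE // sum0 => /eqP.
    rewrite psumr_eq0 => [/allP H|p _]; last exact: sqr_ge0.
    by apply/eqP; rewrite -sqrf_eq0; exact: H.
  have [_ _ _ /(_ (v i) (v j))] := line_coef_jet (inord 5) q.
  rewrite -[v i + v j](congr1 (+%R (v i)) (scale1r (v j))).
  rewrite -[v i - v j](congr1 (+%R (v i)) (scaleN1r (v j))).
  rewrite !zero ?sqrrN ?expr1n // addr0 => /esym/eqP.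
  by rewrite mulrn_eq0 /= addr_eq0 => /eqP.
have := sE (v 0); rewrite sq_form_delta hE // big_seq big1 => [/eqP|q qs].
  by rewrite eq_sym /horn_entry /= oner_eq0.
have G0 : G q 0 = - G q 0.
  by rewrite {1}(next q 0) // (next q 1) // (next q 2) // (next q 3) //
    (next q 4) // !opprK.
rewrite -/(G q 0%N); suff -> : G q 0%N = 0 by rewrite expr0n.
by lra.
Qed.

End Horn.

(* Closedness is taken in the subspace topology of the symmetric matrices. *)
Theorem mainTheorem3 (R : realType) (n : nat) (hn : (6 <= n)%N) :
  \bigcup_r parrilo_cone R n r `<` copositive_cone R n /\
  ~ closed (\bigcup_r parrilo_cone R n r : set (subspace (sym_mx R n))).
Proof.
have nsub : ~ copositive_cone R n `<=` \bigcup_r parrilo_cone R n r.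
  case: n hn => [|[|[|[|[|[|m]]]]]] // _.
  by move=> /(_ _ (@horn_mx_copositive R m))[r _]; exact: horn_mx_notin_parrilo.
split; last by move=> /copositive_sub_closed_bigcup_parrilo.
by split=> // M [r _]; exact: parrilo_sub_copositive.
Qed.
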